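(* Assume the range inclusion $\operatorname{ran}C_{VU}\subseteq\operatorname{ran}C_V$. Then the operator $C_V^\dagger C_{VU}:\mathcal G\to\mathcal H$ is everywhere defined and bounded. Moreover, the affine operator $\gamma^{\mathsf A}_{U|V}\in\mathsf A(\mathcal H;\mathcal G)$ defined by $$\gamma^{\mathsf A}_{U|V}(v):=\mu_U+(C_V^\dagger C_{VU})^*(v-\mu_V)$$ minimizes $\mathcal E_{U|V}(\gamma):=\mathbb E\big[\|U-\gamma\circ V\|_{\mathcal G}^2\big]$ over $\gamma\in\mathsf A(\mathcal H;\mathcal G)$. In particular, $\mathbb E^{\mathsf A}[U|V]=\gamma^{\mathsf A}_{U|V}\circ V$ a.s.
   Context: Standing setup: - $(\Omega,\Sigma,\mathbb P)$ is a probability space and $\mathcal G,\mathcal H$ are separable real Hilbert spaces. - $U\in L^2(\mathbb P;\mathcal G)$ and $V\in L^2(\mathbb P;\mathcal H)$, with Bochner means $\mu_U,\mu_V$. - For $g\in\mathcal G$ and $h\in\mathcal H$, $g\otimes h:\mathcal H\to\mathcal G$ is given by $h'\mapsto\langle h,h'\rangle g$. - $C_{UV}=\mathbb E[(U-\mu_U)\otimes(V-\mu_V)]$, $C_{VU}=C_{UV}^*$ and $C_V=C_{VV}$. - For a bounded linear $A$, $A^\dagger$ denotes its Moore–Penrose pseudo-inverse: the extension of $(A|_{(\ker A)^\perp})^{-1}$ to $\operatorname{ran}A\oplus(\operatorname{ran}A)^\perp$ with kernel $(\operatorname{ran}A)^\perp$. - $\mathsf A(\mathcal H;\mathcal G)$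 is the set of maps $h\mapsto b+Ah$ with $b\in\mathcal G$ and $A$ bounded linear. - $\mathbb E^{\mathsf A}[U|V]$ is the $L^2(\mathbb P;\mathcal G)$-orthogonal projection of $U$ onto the $L^2$-closure of $\{\gamma\circ V:\gamma\in\mathsf A(\mathcal H;\mathcal G)\}$. *)

(* Defs.v *)
From HB Require Import structures.
From mathcomp Require Import all_boot all_order all_algebra.
From mathcomp Require Import all_classical all_reals all_analysis.
Set Implicit Arguments. Unset Strict Implicit. Unset Printing Implicit Defensive.
Import Order.TTheory GRing.Theory Num.Theory.
Import numFieldNormedType.Exports.
Local Open Scope classical_set_scope.
Local Open Scope ring_scope.

Section Defs.
Context {R : realType}.

Definition is_sep_hilbert (E : completeNormedModType R) (ip : E -> E -> R) : Prop :=
  [/\ (forall x y, ip x y = ip y x),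
      (forall (a : R) x y z, ip (a *: x + y) z = a * ip x z + ip y z),
      (forall x, ip x x = `|x| ^+ 2) &
      (exists S : set E, countable S /\ closure S = setT)].

Definition bounded_linear (E F : normedModType R) (A : E -> F) : Prop :=
  (forall (a : R) x y, A (a *: x + y) = a *: A x + A y) /\
  (exists M : R, forall x, `|A x| <= M * `|x|).

Definition is_adjoint (E F : normedModType R) (ipE : E -> E -> R) (ipF : F -> F -> R)
  (A : E -> F) (As : F -> E) : Prop :=
  forall e f, ipE (As f) e = ipF f (A e).

Context {d : measure_display} {Omega : measurableType d} (P : probability Omega R).

(** strong (= weak, by Pettis, in separable spaces) measurability,
    and square Bochner integrability *)
Definition L2 (E : normedModType R) (ip : E -> E -> R) (X : Omega -> E) : Prop :=
  (forall e, measurable_fun setT (fun w => ip (X w) e)) /\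
  P.-integrable setT (fun w => ((`|X w| ^+ 2)%:E)).

Definition is_mean (E : normedModType R) (ip : E -> E -> R) (X : Omega -> E) (mu : E) : Prop :=
  forall e, (\int[P]_w (ip (X w) e)%:E)%E = (ip mu e)%:E.

(** C = C_{XY} = E[(X - muX) (x) (Y - muY)] : F -> E, i.e.
    <e, C f>_E = E[ <Y - muY, f>_F <X - muX, e>_E ]. *)
Definition is_cov (E F : normedModType R) (ipE : E -> E -> R) (ipF : F -> F -> R)
  (X : Omega -> E) (Y : Omega -> F) (muX : E) (muY : F) (C : F -> E) : Prop :=
  forall e f, (\int[P]_w (ipF (Y w - muY) f * ipE (X w - muX) e)%:E)%E
              = (ipE e (C f))%:E.

(** Moore--Penrose pseudo-inverse, as a (functional) relation:
    [mp_pinv ip A y x] iff y lies in ran A (+) (ran A)^perp, i.e. y = A x + s with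
    s orthogonal to ran A, and x is the unique preimage of A x lying in (ker A)^perp;
    then A^dagger y = x. *)
Definition mp_pinv (E F : normedModType R) (ipE : E -> E -> R) (ipF : F -> F -> R)
  (A : E -> F) (y : F) (x : E) : Prop :=
  (exists s : F, (forall e, ipF s (A e) = 0) /\ y = A x + s) /\
  (forall k, A k = 0 -> ipE x k = 0).

Definition mse (G H : normedModType R) (U : Omega -> G) (V : Omega -> H)
  (gamma : H -> G) : \bar R :=
  (\int[P]_w ((`|U w - gamma (V w)| ^+ 2)%:E))%E.

Definition in_affine_closure (G H : normedModType R) (V : Omega -> H) (Z : Omega -> G) : Prop :=
  forall eps : R, 0 < eps -> exists (b : G) (A : H -> G), bounded_linear A /\
    ((\int[P]_w ((`|Z w - (b + A (V w))| ^+ 2)%:E)) < eps%:E)%E.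

(** W is the L^2(P;G)-orthogonal projection E^A[U|V] of U onto that closed subspace *)
Definition is_affine_cond_exp (G H : normedModType R) (ipG : G -> G -> R)
  (U : Omega -> G) (V : Omega -> H) (W : Omega -> G) : Prop :=
  [/\ L2 ipG W, in_affine_closure V W &
      forall Z, L2 ipG Z -> in_affine_closure V Z ->
        (\int[P]_w (ipG (U w - W w) (Z w))%:E)%E = 0%E ].

End Defs.

(* Main.v *)
Require Import Defs.
From HB Require Import structures.
From mathcomp Require Import all_boot all_order all_algebra.
From mathcomp Require Import all_classical all_reals all_analysis.
From mathcomp Require Import measurable_realfun ring lra.
Set Implicit Arguments.
Unset Strict Implicit.
Unset Printing Implicit Defensive.
Import Order.TTheory GRing.Theory Num.Theory.
Import numFieldNormedType.Exports.
Local Open Scope classical_set_scope.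
Local Open Scope ring_scope.

(* By the range inclusion, B g := C_V^+ C_VU g exists: it is the projection onto the closure
   of ran C_V = (ker C_V)^perp of any solution h of C_V h = C_VU g. It is bounded by the
   uniform boundedness principle, since <B g, C_V k> = <C_VU g, k>. With D := U - W,
   W := mu_U + B^* (V - mu_V), the identity C_V B = C_VU says that D is centered and that
   all the scalar correlations E[<D, g> <V - mu_V, h>] vanish; truncating by orthogonal
   projections of finite rank, D is then L^2-orthogonal to b + A V for every bounded A.
   This orthogonality gives minimality and, passing to the closure, the projection. *)

Lemma mulr_le_sqrD {R : realDomainType} (a b : R) : 0 <= a -> 0 <= b -> a * b <= a ^+ 2 + b ^+ 2.
Proof. by move=> a0 b0; have := sqr_ge0 (a - b); nra. Qed.

Definition adherent {R : realType} {E : normedModType R} (M : set E) (p : E) :=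
  forall eps, 0 < eps -> exists2 m, M m & `|p - m| < eps.

(** * Geometry of separable Hilbert spaces: projections, Riesz representation, Gram-Schmidt *)

Section Hilbert.
Context {R : realType} {E : completeNormedModType R} {ip : E -> E -> R}.
Hypothesis hE : is_sep_hilbert ip.
Implicit Types (x y z : E) (a : R).

Lemma ipC x y : ip x y = ip y x. Proof. by case: hE. Qed.

Lemma ipxx x : ip x x = `|x| ^+ 2. Proof. by case: hE. Qed.

Lemma ipDl x y z : ip (x + y) z = ip x z + ip y z.
Proof. by case: hE => _ h _ _; rewrite -[x in LHS]scale1r h mul1r. Qed.

Lemma ip0l x : ip 0 x = 0.
Proof. by apply: (addrI (ip 0 x)); rewrite -ipDl !addr0. Qed.

Lemma ipZl a x y : ip (a *: x) y = a * ip x y.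
Proof. by case: hE => _ h _ _; rewrite -[_ *: _]addr0 h ip0l addr0. Qed.

Lemma ipNl x y : ip (- x) y = - ip x y.
Proof. by rewrite -scaleN1r ipZl mulN1r. Qed.

Lemma ipBl x y z : ip (x - y) z = ip x z - ip y z.
Proof. by rewrite ipDl ipNl. Qed.

Lemma ip0r x : ip x 0 = 0. Proof. by rewrite ipC ip0l. Qed.

Lemma ipDr x y z : ip z (x + y) = ip z x + ip z y.
Proof. by rewrite ipC ipDl !(ipC z). Qed.

Lemma ipZr a x y : ip x (a *: y) = a * ip x y.
Proof. by rewrite ipC ipZl (ipC x). Qed.

Lemma ipNr x y : ip x (- y) = - ip x y.
Proof. by rewrite ipC ipNl (ipC x). Qed.

Lemma ipBr x y z : ip z (x - y) = ip z x - ip z y.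
Proof. by rewrite ipDr ipNr. Qed.

Lemma ip_ext x y : (forall z, ip x z = ip y z) -> x = y.
Proof.
move=> h; apply/eqP; rewrite -subr_eq0 -normr_eq0 -sqrf_eq0 -ipxx ipBl h.
by rewrite subrr.
Qed.

Lemma sqr_normB x y : `|x - y| ^+ 2 = `|x| ^+ 2 - 2 * ip x y + `|y| ^+ 2.
Proof. by rewrite -!ipxx ipBl !ipBr (ipC y x); ring. Qed.

Lemma sqr_normD x y : `|x + y| ^+ 2 = `|x| ^+ 2 + 2 * ip x y + `|y| ^+ 2.
Proof. by rewrite -!ipxx ipDl !ipDr (ipC y x); ring. Qed.

(** Specialise to the minimizing [a], which is <x,y>/|y|^2. Taking c = |x|^2 gives Cauchy-Schwarz;
    in [orth_proj] a small [c] says that an almost minimal residual is almost orthogonal to [M]. *)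
Lemma ip_sqr_le x y c : 0 <= c ->
  (forall a, `|x| ^+ 2 <= `|x - a *: y| ^+ 2 + c) -> ip x y ^+ 2 <= c * `|y| ^+ 2.
Proof.
move=> c0 h; have [->|y0] := eqVneq y 0.
  by rewrite ip0r expr0n /= mulr_ge0 // sqr_ge0.
have y2 : 0 < `|y| ^+ 2 by rewrite exprn_gt0 // normr_gt0.
have := h (ip x y / `|y| ^+ 2).
rewrite sqr_normB ipZr normrZ exprMn real_normK ?num_real //.
move=> h1; rewrite -ler_pdivrMr //.
rewrite [_ * `|y| ^+ 2](_ : _ = ip x y ^+ 2 / `|y| ^+ 2) in h1; last first.
  by field; rewrite normr_eq0.
rewrite [2 * _](_ : _ = 2 * (ip x y ^+ 2 / `|y| ^+ 2)) in h1; last by field; rewrite normr_eq0.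
lra.
Qed.

Lemma ip_le_norm x y : `|ip x y| <= `|x| * `|y|.
Proof.
rewrite -ler_sqr ?nnegrE ?mulr_ge0 // real_normK ?num_real // exprMn.
by apply: ip_sqr_le; rewrite ?sqr_ge0 // => a; rewrite lerDr sqr_ge0.
Qed.

Lemma ip_le_sqr x y : `|ip x y| <= `|x| ^+ 2 + `|y| ^+ 2.
Proof.
by rewrite (le_trans (ip_le_norm _ _)) // mulr_le_sqrD.
Qed.

Lemma cvg_ip (u : nat -> E) x y : u n @[n --> \oo] --> y ->
  ip x (u n) @[n --> \oo] --> ip x y.
Proof.
move=> /cvgrPdist_lt uy; apply/cvgrPdist_lt => e e0.
have x1 : 0 < `|x| + 1 by rewrite ltr_wpDl.
have [N _ hN] := uy _ (divr_gt0 e0 x1); exists N => // n /hN.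
rewrite /= ltr_pdivlMr // => h; rewrite -ipBr (le_lt_trans (ip_le_norm _ _)) //.
by apply: le_lt_trans h; rewrite mulrC ler_wpM2l // lerDl.
Qed.

Definition linear_subspace (M : set E) := M 0 /\ forall a x y, M x -> M y -> M (a *: x + y).

Lemma linear_subspaceZ (M : set E) a x : linear_subspace M -> M x -> M (a *: x).
Proof. by move=> [M0 hM] Mx; rewrite -[_ *: _]addr0; exact: hM. Qed.

Lemma linear_subspaceD (M : set E) x y : linear_subspace M -> M x -> M y -> M (x + y).
Proof. by move=> [M0 hM] Mx My; rewrite -[x]scale1r; exact: hM. Qed.

Lemma parallelogram x y z :
  `|y - z| ^+ 2 = 2 * `|x - y| ^+ 2 + 2 * `|x - z| ^+ 2 - 4 * `|x - 2^-1 *: (y + z)| ^+ 2.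
Proof.
rewrite !sqr_normB ipZr ipDr normrZ exprMn sqr_normD ger0_norm //.
by field.
Qed.

(** A minimizing sequence for the distance to [M] is Cauchy by the parallelogram law; its limit lies
    in the closure of [M], whence [adherent]. *)
Lemma orth_proj (M : set E) x : linear_subspace M -> exists p,
  adherent M p /\ (forall m, M m -> ip (x - p) m = 0).
Proof.
move=> hM; pose D := [set `|x - m| ^+ 2 | m in M].
have D0 : D !=set0 by exists (`|x - 0| ^+ 2), 0 => //; case: hM.
have Dlb : lbound D 0 by move=> _ [m Mm <-]; rewrite sqr_ge0.
have hD : has_inf D by split => //; exists 0.
have dle m : M m -> inf D <= `|x - m| ^+ 2.
  by move=> Mm; apply: ge_inf; [exists 0|exists m].
have /choice[m hm] : forall n : nat, exists m, M m /\ `|x - m| ^+ 2 < inf D + n.+1%:R^-1.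
  move=> n; have n0 : 0 < n.+1%:R^-1 :> R by rewrite invr_gt0.
  have [_ [m Mm <-] ?] := inf_adherent n0 hD.
  by exists m.
(* The midpoint lies in [M], so its squared distance to [x] is at least the infimum, which those of
   [m n] and [m k] barely exceed. *)
have near_m n k : `|m n - m k| ^+ 2 <= 2 * n.+1%:R^-1 + 2 * k.+1%:R^-1.
  rewrite (parallelogram x).
  have [Mn hn] := hm n; have [Mk hk] := hm k.
  have := dle (2^-1 *: (m n + m k)).
  move=> /(_ (linear_subspaceZ _ hM (linear_subspaceD hM Mn Mk))).
  move: hn hk; set a := n.+1%:R^-1; set b := k.+1%:R^-1.
  move: (_ ^+ 2) (_ ^+ 2) (_ ^+ 2) => p q r.
  move: (inf D) => i.
  move=> h1 h2 h3; lra.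
have small (e : R) : 0 < e -> exists N, forall n, (N <= n)%N -> n.+1%:R^-1 < e.
  move=> e0; have := @near_infty_natSinv_lt R (PosNum e0).
  by move=> -[N _ hN]; exists N => n Nn; exact: hN.
have cm : cvgn (m : nat -> E).
  apply/cauchy_cvgP/cauchy_exP => e e0.
  have [N hN] : exists N, forall n, (N <= n)%N -> n.+1%:R^-1 < e ^+ 2 / 4.
    by apply: small; rewrite divr_gt0 // exprn_gt0.
  exists (m N), N => // n Nn /=; rewrite -ball_normE /=.
  rewrite -ltr_sqr ?nnegrE ?(ltW e0) //.
  apply: le_lt_trans (near_m _ _) _.
  move: (hN _ (leqnn N)) (hN _ Nn); set a := N.+1%:R^-1; set b := n.+1%:R^-1.
  by move: (e ^+ 2) => c h1 h2; lra.
have lm : forall e : R, 0 < e -> exists N, forall n, (N <= n)%N -> `|limn m - m n| < e.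
  by move=> e e0; have /cvgrPdist_lt/(_ _ e0)[N _ hN] := cm; exists N => n Nn; exact: hN.
exists (limn m); split => [e /lm[N hN]|y My].
  by exists (m N); [case: (hm N)|exact: hN].
apply/eqP; rewrite -normr_le0; apply/ler_addgt0Pr => e e0; rewrite add0r.
(* Each half of the split below, [x - m N] and [m N - limn m], costs at most c|y|, and this choice
   gives 2c|y| < e. *)
have [c c0 hc] : exists2 c : R, 0 < c & c * `|y| + c = e / 2.
  have y1 : 0 < `|y| + 1 by rewrite ltr_wpDl.
  exists (e / (2 * (`|y| + 1))); first by rewrite divr_gt0 // mulr_gt0.
  by field; rewrite gt_eqF.
have [N1 hN1] := lm _ c0.
have [N2 hN2] := small _ (exprn_gt0 2 c0).
pose N := maxn N1 N2.
rewrite [x - _](_ : _ = (x - m N) + (m N - limn m)); last by rewrite addrA subrK.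
rewrite ipDl (le_trans (ler_normD _ _)) //.
have h1 : `|ip (x - m N) y| <= c * `|y|.
  rewrite -ler_sqr ?nnegrE ?mulr_ge0 ?(ltW c0) // real_normK ?num_real // exprMn.
  (* m N + a y stays in [M], so its squared distance to [x] is at least [inf D], which that of [m N]
     exceeds by less than c^2. *)
  apply: ip_sqr_le => [|a]; first exact: sqr_ge0.
  rewrite -addrA -opprD [m N + _]addrC.
  have [Mn hn] := hm N.
  move: (dle _ (hM.2 a _ _ My Mn)) (hN2 N (leq_maxr _ _)) hn.
  set b := N.+1%:R^-1; move: (c ^+ 2) (_ ^+ 2) (_ ^+ 2) (inf D) => p q r i.
  by move=> h1 h2 h3; lra.
have h2 : `|ip (m N - limn m) y| <= c * `|y|.
  rewrite (le_trans (ip_le_norm _ _)) // ler_wpM2r // distrC ltW //.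
  exact: (hN1 N (leq_maxl _ _)).
move: h1 h2 hc c0; move: (ip _ _) (ip _ _) (c * _) => p q r.
clear; move: (e : R) => {}e h1 h2 h3 h4; lra.
Qed.

(** If f x0 is nonzero, the part [q] of [x0] orthogonal to ker f spans the orthogonal complement of
    ker f, and a multiple of it represents [f]. *)
Lemma riesz (f : E -> R) : (forall a x y, f (a *: x + y) = a * f x + f y) ->
  (exists C, forall x, `|f x| <= C * `|x|) -> exists r, forall x, ip r x = f x.
Proof.
move=> fl [C fC].
have f0 : f 0 = 0 by have := fl (-1) 0 0; rewrite scaleN1r oppr0 addr0 mulN1r addNr.
have fZ a x : f (a *: x) = a * f x by rewrite -[_ *: _]addr0 fl f0 addr0.
have fB x y : f (x - y) = f x - f y by rewrite addrC -scaleN1r fl mulN1r addrC.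
have [[x0 fx0]|nf] := pselect (exists x0, f x0 != 0); last first.
  by exists 0 => x; rewrite ip0l; apply/esym/eqP/negPn/negP => h; apply: nf; exists x.
have [p [hp orth]] : exists p, adherent [set x | f x = 0] p /\
    (forall m, f m = 0 -> ip (x0 - p) m = 0).
  apply: (@orth_proj [set x | f x = 0]); split => //= a x y hx hy.
  by rewrite fl hx hy mulr0 addr0.
(* [p] is a limit of kernel elements, and boundedness of [f] makes [f] vanish there too. *)
have fp : f p = 0.
  apply/eqP; rewrite -normr_le0; apply/ler_addgt0Pr => e e0; rewrite add0r.
  have C1 : 0 < `|C| + 1 by rewrite ltr_wpDl.
  have [m fm hm] := hp _ (divr_gt0 e0 C1).
  rewrite -[f p]subr0 -fm -fB (le_trans (fC _)) //.
  apply: (@le_trans _ _ ((`|C| + 1) * `|p - m|)).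
    by rewrite ler_wpM2r // (le_trans (ler_norm _)) // lerDl.
  by rewrite mulrC -ler_pdivlMr // ltW.
set q := x0 - p in orth.
have fq : f q = f x0 by rewrite /q fB fp subr0.
have q0 : `|q| != 0.
  by rewrite normr_eq0; apply: contra_neq fx0 => q0; rewrite -fq q0 f0.
exists ((f q / `|q| ^+ 2) *: q) => x.
(* This vector lies in ker f, hence is orthogonal to [q]; solving for <q, x> gives the claim. *)
have := orth (x - (f x / f q) *: q).
rewrite fB fZ divfK ?fq // subrr => /(_ erefl)/eqP.
rewrite ipBr ipZr ipxx ipZl subr_eq0 => /eqP ->.
by field; rewrite q0 fx0.
Qed.

(** Orthogonal projection onto the span of s 0, ..., s (n-1), by Gram-Schmidt without normalization.
    If [s k] depends linearly on its predecessors, then u = 0 and the added term vanishes. *)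
Fixpoint gs_proj (s : nat -> E) n y :=
  if n is k.+1 then
    let u := s k - gs_proj s k (s k) in
    gs_proj s k y + (ip y u / `|u| ^+ 2) *: u
  else 0.

Section GramSchmidt.
Variable s : nat -> E.
Local Notation P := (gs_proj s).

Lemma gs_projP n a x y : P n (a *: x + y) = a *: P n x + P n y.
Proof.
elim: n => [|n IH] /=; first by rewrite scaler0 addr0.
rewrite IH; move: (s n - _) => u.
by rewrite ipDl ipZl mulrDl scalerDl scalerDr scalerA mulrA addrACA.
Qed.

Lemma gs_projB n x y : P n (x - y) = P n x - P n y.
Proof. by rewrite addrC -scaleN1r gs_projP scaleN1r addrC. Qed.

Lemma gs_proj_sym n x y : ip (P n x) y = ip x (P n y).
Proof.
elim: n => [|n IH] /=; first by rewrite ip0l ip0r.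
move: (s n - _) => u; rewrite ipDl ipDr IH ipZl ipZr; congr (_ + _).
by rewrite (ipC _ y); ring.
Qed.

(** The new direction [u] is killed by the previous projection, so by symmetry it is orthogonal to
    its range. *)
Lemma gs_proj_idem n x : P n (P n x) = P n x.
Proof.
elim: n x => //= n IH x; set u := s n - _.
have Pu : P n u = 0 by rewrite /u gs_projB IH subrr.
rewrite [X in P n X]addrC gs_projP Pu scaler0 add0r IH; congr (_ + _).
congr (_ *: _); rewrite ipDl gs_proj_sym Pu ip0r add0r ipZl ipxx.
have [->|u0] := eqVneq `|u| 0; first by rewrite expr0n /= !invr0 !mulr0.
by field.
Qed.

Lemma gs_proj_fix n i : (i < n)%N -> P n (s i) = s i.
Proof.
elim: n => //= n IH; rewrite ltnS leq_eqVlt => /predU1P[->|/IH Pi]; set u := s n - _;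
    have Pu : P n u = 0 by rewrite /u gs_projB gs_proj_idem subrr.
  have -> : ip (s n) u = `|u| ^+ 2.
    rewrite -{1}(subrK (P n (s n)) (s n)) -/u ipDl ipxx gs_proj_sym Pu ip0r.
    by rewrite addr0.
  have [u0|u0] := eqVneq `|u| 0.
    move/eqP: (u0); rewrite normr_eq0 => /eqP uu.
    by rewrite uu scaler0 addr0; apply/esym/eqP; rewrite -subr_eq0 -/u uu.
  by rewrite divff ?sqrf_eq0 // scale1r addrC subrK.
by rewrite -{2}Pi gs_proj_sym Pu ip0r mul0r scale0r addr0.
Qed.

Lemma gs_proj_norm n x : `|P n x| <= `|x|.
Proof.
have [->|p0] := eqVneq (P n x) 0; first by rewrite normr0.
rewrite -(@ler_pM2r _ `|P n x|) ?normr_gt0 // -expr2 -ipxx.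
by rewrite -gs_proj_sym gs_proj_idem gs_proj_sym (le_trans (ler_norm _)) // ip_le_norm.
Qed.

Lemma gs_projC_norm n x : `|x - P n x| <= `|x|.
Proof.
have [->|p0] := eqVneq (x - P n x) 0; first by rewrite normr0.
rewrite -(@ler_pM2r _ `|x - P n x|) ?normr_gt0 // -expr2 -ipxx.
rewrite ipBr -gs_proj_sym gs_projB gs_proj_idem subrr ip0l subr0.
by rewrite ipC (le_trans (ler_norm _)) // ip_le_norm.
Qed.

(** For n > i the operator I - P n kills [s i], so it sends [x] to (I - P n)(x - s i), of norm at
    most |x - s i|. *)
Lemma cvg_gs_proj x : (forall y eps, 0 < eps -> exists i, `|y - s i| < eps) ->
  P n x @[n --> \oo] --> x.
Proof.
move=> dense; apply/cvgrPdist_lt => e e0.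
have [i hi] := dense x e e0.
exists i.+1 => // n /= ni.
rewrite (_ : x - P n x = (x - s i) - P n (x - s i)).
  exact: le_lt_trans (gs_projC_norm _ _) hi.
by rewrite gs_projB (gs_proj_fix ni) opprB addrA subrK.
Qed.

End GramSchmidt.

Lemma sep_dense_seq : exists s : nat -> E,
  forall y eps, 0 < eps -> exists i, `|y - s i| < eps.
Proof.
case: hE => _ _ _ [S [cS dS]].
have near_S y eps : 0 < eps -> exists2 z, S z & `|y - z| < eps.
  move=> e0; have : closure S y by rewrite dS.
  move=> /(_ (ball y eps)) /(_ (nbhsx_ballx _ _ e0))[z [Sz]].
  by rewrite -ball_normE /= => h; exists z.
have /countable_injP[f injf] := cS.
(* Inverts the injection [f] of the countable dense set into the naturals; indices outside its image
   get the default value 0. *)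
have /choice[s hs] : forall i, exists z, forall y, S y -> f y = i -> z = y.
  move=> i; have [[z [Sz fz]]|nz] := pselect (exists z, S z /\ f z = i); last first.
    by exists 0 => y Sy fy; case: nz; exists y.
  by exists z => y Sy fy; apply: injf; [exact: mem_set|exact: mem_set|rewrite fz fy].
by exists s => y eps e0; have [z Sz h] := near_S y eps e0; exists (f z); rewrite (hs _ z).
Qed.

End Hilbert.

(** Riesz applied to x |-> <f, A x>; the bound follows from |As f|^2 = <f, A (As f)>. *)
Lemma adjoint_exists {R : realType} {E F : completeNormedModType R} {ipE : E -> E -> R}
  {ipF : F -> F -> R} (hE : is_sep_hilbert ipE) (hF : is_sep_hilbert ipF) (A : E -> F) :
  bounded_linear A -> exists2 As : F -> E, bounded_linear As & is_adjoint ipE ipF A As.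
Proof.
move=> [lA [C hC]].
have hC' x : `|A x| <= `|C| * `|x|.
  by rewrite (le_trans (hC x)) // ler_wpM2r // ler_norm.
have /choice[As hAs] : forall f, exists r, forall x, ipE r x = ipF f (A x).
  move=> f; apply: (riesz hE) => [a x y|]; first by rewrite lA (ipDr hF) (ipZr hF).
  exists (`|f| * `|C|) => x; rewrite (le_trans (ip_le_norm hF _ _)) // -mulrA.
  by rewrite ler_wpM2l.
exists As; last by [].
split=> [a x y|].
  by apply: (ip_ext hE) => z; rewrite (ipDl hE) (ipZl hE) !hAs (ipDl hF) (ipZl hF).
exists `|C| => f; have [->|p0] := eqVneq (As f) 0.
  by rewrite normr0 mulr_ge0.
rewrite -(@ler_pM2r _ `|As f|) ?normr_gt0 // -expr2 -(ipxx hE) hAs.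
rewrite (le_trans (ler_norm _)) // (le_trans (ip_le_norm hF _ _)) //.
by rewrite -mulrA mulrCA ler_wpM2l.
Qed.

Lemma bounded_linearP {R : realType} {E F : normedModType R} (A : E -> F) :
  bounded_linear A -> exists2 C : R, 0 <= C & forall x, `|A x| <= C * `|x|.
Proof.
move=> [_ [C hC]]; exists `|C| => // x.
by rewrite (le_trans (hC x)) // ler_wpM2r // ler_norm.
Qed.

Lemma bounded_linear0 {R : realType} {E F : normedModType R} (A : E -> F) :
  bounded_linear A -> A 0 = 0.
Proof.
by move=> [lA _]; have := lA (-1) 0 0; rewrite scaleN1r oppr0 addr0 scaleN1r addNr.
Qed.

Lemma bounded_linearZ {R : realType} {E F : normedModType R} (A : E -> F) a x :
  bounded_linear A -> A (a *: x) = a *: A x.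
Proof. by move=> bA; rewrite -[_ *: x]addr0 bA.1 (bounded_linear0 bA) addr0. Qed.

Lemma bounded_linearD {R : realType} {E F : normedModType R} (A : E -> F) x y :
  bounded_linear A -> A (x + y) = A x + A y.
Proof. by move=> bA; have := bA.1 1 x y; rewrite !scale1r. Qed.

Lemma bounded_linearB {R : realType} {E F : normedModType R} (A : E -> F) x y :
  bounded_linear A -> A (x - y) = A x - A y.
Proof. by move=> bA; rewrite addrC -scaleN1r bA.1 scaleN1r addrC. Qed.

(** * Square-integrable random vectors *)

Section L2.
Context {R : realType} {d : measure_display} {Omega : measurableType d}.
Variable P : probability Omega R.

Local Notation integ f := (P.-integrable setT (EFin \o f)).

Lemma integD (f g : Omega -> R) : integ f -> integ g -> integ (fun w => f w + g w).
Proof. by move=> hf hg; exact: (integrableD measurableT hf hg). Qed.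

Lemma integZ a (f : Omega -> R) : integ f -> integ (fun w => a * f w).
Proof. by move=> hf; exact: (integrableZl measurableT a hf). Qed.

Lemma integ_cst (a : R) : integ (fun=> a).
Proof. exact: (finite_measure_integrable_cst P a measurableT). Qed.

Lemma integ_le (f g : Omega -> R) : measurable_fun setT f -> (forall w, `|f w| <= g w) ->
  integ g -> integ f.
Proof.
move=> mf fg; apply: le_integrable => //; first exact/measurable_EFinP.
by move=> w _ /=; rewrite lee_fin (le_trans (fg w)) // ler_norm.
Qed.

(** The inner product of L^2(P; E), real-valued for arithmetic; [integral_ip] ties it to the
    extended-real integrals of the statement. *)
Definition L2ip (E : normedModType R) (ip : E -> E -> R) (X Y : Omega -> E) :=
  \int[P]_w ip (X w) (Y w).

Section OneSpace.
Context {E : completeNormedModType R} {ip : E -> E -> R}.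
Hypothesis hE : is_sep_hilbert ip.
Implicit Types X Y : Omega -> E.

(** Measurability is only weak here. Projecting [Y] to finite rank leaves finite sums of products of
    measurable scalars, which converge pointwise by separability. *)
Lemma measurable_ip X Y : (forall e, measurable_fun setT (fun w => ip (X w) e)) ->
  (forall e, measurable_fun setT (fun w => ip (Y w) e)) ->
  measurable_fun setT (fun w => ip (X w) (Y w)).
Proof.
move=> mX mY; have [s ds] := sep_dense_seq hE.
apply: (@measurable_fun_cvg _ _ _ setT (fun n w => ip (X w) (gs_proj (ip := ip) s n (Y w)))).
  elim=> [|n IH] /=; first by under eq_fun do rewrite (ip0r hE); exact: measurable_cst.
  move: (s n - _) => u.
  under eq_fun do rewrite (ipDr hE) (ipZr hE).
  apply: measurable_funD => //; apply: measurable_funM => //.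
  by apply: measurable_funM => //; exact: measurable_cst.
by move=> w _; apply: (cvg_ip hE); apply: (cvg_gs_proj hE).
Qed.

Lemma L2_bounded X (g : Omega -> R) : (forall e, measurable_fun setT (fun w => ip (X w) e)) ->
  integ g -> (forall w, `|X w| ^+ 2 <= g w) -> L2 P ip X.
Proof.
move=> mX ig hg; split=> //; apply: integ_le ig; last first.
  by move=> w; rewrite ger0_norm ?sqr_ge0.
under eq_fun do rewrite -(ipxx hE); exact: measurable_ip.
Qed.

Lemma L2_cst e : L2 P ip (fun=> e).
Proof.
apply: (@L2_bounded _ (fun=> `|e| ^+ 2)) => //; last exact: integ_cst.
Qed.

Lemma L2_lin a X Y : L2 P ip X -> L2 P ip Y -> L2 P ip (fun w => a *: X w + Y w).
Proof.
move=> [mX iX] [mY iY].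
apply: (@L2_bounded _ (fun w => 2 * a ^+ 2 * `|X w| ^+ 2 + 2 * `|Y w| ^+ 2)).
- move=> e; under eq_fun do rewrite (ipDl hE) (ipZl hE).
  by apply: measurable_funD => //; apply: measurable_funM => //; exact: measurable_cst.
- by apply: integD; apply: integZ.
- move=> w.
  have := sqr_ge0 `|a *: X w - Y w|; rewrite (sqr_normB hE) (sqr_normD hE).
  rewrite normrZ exprMn real_normK ?num_real //.
  move: (ip _ _) (`|X w| ^+ 2) (`|Y w| ^+ 2) (a ^+ 2) => p q r b h; lra.
Qed.

Lemma L2D X Y : L2 P ip X -> L2 P ip Y -> L2 P ip (fun w => X w + Y w).
Proof. by move=> hX hY; have := L2_lin 1 hX hY; under eq_fun do rewrite scale1r. Qed.

Lemma L2B X Y : L2 P ip X -> L2 P ip Y -> L2 P ip (fun w => X w - Y w).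
Proof.
by move=> hX hY; have := L2_lin (-1) hY hX; under eq_fun do rewrite scaleN1r addrC.
Qed.

Lemma integ_ip X Y : L2 P ip X -> L2 P ip Y -> integ (fun w => ip (X w) (Y w)).
Proof.
move=> [mX iX] [mY iY]; apply: integ_le (integD iX iY); first exact: measurable_ip.
by move=> w; exact: (ip_le_sqr hE).
Qed.

Lemma integral_ip X Y : L2 P ip X -> L2 P ip Y ->
  (\int[P]_w (ip (X w) (Y w))%:E)%E = (L2ip ip X Y)%:E.
Proof.
move=> hX hY; rewrite fineK //.
exact: (integrable_fin_num measurableT (integ_ip hX hY)).
Qed.

Lemma integral_sqr_norm X : L2 P ip X ->
  (\int[P]_w (`|X w| ^+ 2)%:E)%E = (L2ip ip X X)%:E.
Proof.
by move=> hX; rewrite -integral_ip //; apply: eq_integral => w _; rewrite (ipxx hE).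
Qed.

Lemma L2ip_eq X X' Y Y' : X =1 X' -> Y =1 Y' -> L2ip ip X Y = L2ip ip X' Y'.
Proof. by move=> /funext -> /funext ->. Qed.

Lemma L2ipC X Y : L2ip ip X Y = L2ip ip Y X.
Proof. by apply: eq_Rintegral => w _; rewrite (ipC hE). Qed.

Lemma L2ip_linl a X Y Z : L2 P ip X -> L2 P ip Y -> L2 P ip Z ->
  L2ip ip (fun w => a *: X w + Y w) Z = a * L2ip ip X Z + L2ip ip Y Z.
Proof.
move=> hX hY hZ.
have iXZ := integ_ip hX hZ; have iYZ := integ_ip hY hZ.
transitivity (\int[P]_w (a * ip (X w) (Z w) + ip (Y w) (Z w))).
  by apply: eq_Rintegral => w _; rewrite (ipDl hE) (ipZl hE).
by rewrite (RintegralD measurableT (integZ a iXZ) iYZ) (RintegralZl _ measurableT iXZ).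
Qed.

Lemma L2ipDl X Y Z : L2 P ip X -> L2 P ip Y -> L2 P ip Z ->
  L2ip ip (fun w => X w + Y w) Z = L2ip ip X Z + L2ip ip Y Z.
Proof.
move=> hX hY hZ; rewrite -[L2ip ip X Z]mul1r -L2ip_linl //.
by apply: L2ip_eq => // w; rewrite scale1r.
Qed.

Lemma L2ipBl X Y Z : L2 P ip X -> L2 P ip Y -> L2 P ip Z ->
  L2ip ip (fun w => X w - Y w) Z = L2ip ip X Z - L2ip ip Y Z.
Proof.
move=> hX hY hZ; rewrite addrC -mulN1r -L2ip_linl //.
by apply: L2ip_eq => // w; rewrite scaleN1r addrC.
Qed.

Lemma L2ipDr X Y Z : L2 P ip X -> L2 P ip Y -> L2 P ip Z ->
  L2ip ip Z (fun w => X w + Y w) = L2ip ip Z X + L2ip ip Z Y.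
Proof. by move=> hX hY hZ; rewrite L2ipC L2ipDl // !(L2ipC Z). Qed.

Lemma L2ipBr X Y Z : L2 P ip X -> L2 P ip Y -> L2 P ip Z ->
  L2ip ip Z (fun w => X w - Y w) = L2ip ip Z X - L2ip ip Z Y.
Proof. by move=> hX hY hZ; rewrite L2ipC L2ipBl // !(L2ipC Z). Qed.

Lemma L2ip_ge0 X : 0 <= L2ip ip X X.
Proof. by apply: Rintegral_ge0 => w _; rewrite (ipxx hE) sqr_ge0. Qed.

(** A Cauchy-Schwarz bound free of square roots: the quadratic b |-> E|bX + Y|^2 is nonnegative at b
    = t and b = -t. *)
Lemma L2ip_amgm t X Y : L2 P ip X -> L2 P ip Y -> 0 < t ->
  2 * `|L2ip ip X Y| <= t * L2ip ip X X + L2ip ip Y Y / t.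
Proof.
move=> hX hY t0.
have key b : 0 <= b ^+ 2 * L2ip ip X X + 2 * b * L2ip ip X Y + L2ip ip Y Y.
  have := L2ip_ge0 (fun w => b *: X w + Y w).
  rewrite L2ip_linl //; last exact: L2_lin.
  rewrite !(L2ipC _ (fun w => b *: X w + Y w)) !L2ip_linl // (L2ipC Y X).
  by move: (L2ip ip X X) (L2ip ip X Y) (L2ip ip Y Y) => p q r; nra.
rewrite -(@ler_pM2l _ t) // mulrDr [t * (_ / t)]mulrC divfK ?gt_eqF //.
have := key t; have := key (- t); rewrite sqrrN expr2.
case: (ler0P (L2ip ip X Y)) => _;
  by move: (L2ip ip X X) (L2ip ip X Y) (L2ip ip Y Y) => p q r; lra.
Qed.

End OneSpace.

Section TwoSpaces.
Context {E F : completeNormedModType R} {ipE : E -> E -> R} {ipF : F -> F -> R}.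
Hypotheses (hE : is_sep_hilbert ipE) (hF : is_sep_hilbert ipF).

(** The adjoint moves [A] onto the test vector, so weak measurability of [X] passes to its image. *)
Lemma L2_bounded_linear (A : E -> F) X : bounded_linear A -> L2 P ipE X ->
  L2 P ipF (fun w => A (X w)).
Proof.
move=> bA [mX iX]; have [As bAs hAs] := adjoint_exists hE hF bA.
have [C C0 hC] := bounded_linearP bA.
apply: (L2_bounded hF (g := fun w => C ^+ 2 * `|X w| ^+ 2)).
- by move=> f; under eq_fun do rewrite (ipC hF) -hAs (ipC hE); exact: mX.
- exact: integZ.
- by move=> w; rewrite -exprMn ler_sqr ?nnegrE ?mulr_ge0.
Qed.

Lemma rank1_bounded_linear (e : E) (f : F) : bounded_linear (fun x => ipE x e *: f).
Proof.
split=> [a x y|]; first by rewrite (ipDl hE) (ipZl hE) scalerDl scalerA.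
exists (`|e| * `|f|) => x; rewrite normrZ mulrAC ler_wpM2r //.
by rewrite mulrC ip_le_norm.
Qed.

(** The integrand is the inner product of [Y] with the image of [X] under the rank-one map x |->
    <x,e> f. *)
Lemma integ_ip_mul X Y e f : L2 P ipE X -> L2 P ipF Y ->
  integ (fun w => ipE (X w) e * ipF (Y w) f).
Proof.
move=> hX hY.
have := integ_ip hF (L2_bounded_linear (rank1_bounded_linear e f) hX) hY.
by under [in X in X -> _]eq_fun do rewrite (ipZl hF) (ipC hF f).
Qed.

End TwoSpaces.

Section Uncorrelated.
Context {E F : completeNormedModType R} {ipE : E -> E -> R} {ipF : F -> F -> R}.
Hypotheses (hE : is_sep_hilbert ipE) (hF : is_sep_hilbert ipF).

(* The hypothesis gives the claim for finite rank truncations of A; these converge strongly to A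
   and dominated convergence applies. *)
Lemma L2ip_uncorrelated (A : F -> E) X Y : bounded_linear A ->
  L2 P ipE X -> L2 P ipF Y ->
  (forall e f, \int[P]_w (ipE (X w) e * ipF (Y w) f) = 0) ->
  L2ip ipE X (fun w => A (Y w)) = 0.
Proof.
move=> bA hX hY unc; have [As _ hAs] := adjoint_exists hF hE bA.
have [s ds] := sep_dense_seq hE.
pose Q := gs_proj (ip := ipE) s.
have bQ n : bounded_linear (Q n).
  split=> [a x y|]; first exact: (gs_projP hE).
  by exists 1 => x; rewrite mul1r (gs_proj_norm hE).
have hAY := L2_bounded_linear hF hE bA hY.
have hQ n : L2 P ipE (fun w => Q n (A (Y w))) by exact: (L2_bounded_linear hE hE).
have Q0 n : L2ip ipE X (fun w => Q n (A (Y w))) = 0.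
  elim: n => [|n IH].
    by rewrite /L2ip /Q /=; under eq_Rintegral do rewrite (ip0r hE); rewrite Rintegral_cst // mul0r.
  have bu := rank1_bounded_linear hE (s n - Q n (s n)) (s n - Q n (s n)).
  rewrite /Q /= -/(Q n); move: (s n - Q n (s n)) bu => u bu.
  have hu : L2 P ipE (fun w => ipE (A (Y w)) u *: u) by exact: (L2_bounded_linear hE hE bu hAY).
  transitivity (L2ip ipE X (fun w => `|u| ^- 2 *: (ipE (A (Y w)) u *: u) + Q n (A (Y w)))).
    by apply: L2ip_eq => // w; rewrite addrC scalerA mulrC.
  rewrite (L2ipC hE) (L2ip_linl hE) // !(L2ipC hE _ X) IH addr0.
  (* Up to scale the new rank-one term contributes E[<X,u><Y, As u>], which is zero by [unc]. *)
  rewrite [X in _ * X](_ : _ = 0) ?mulr0 // -[RHS](unc u (As u)).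
  apply: eq_Rintegral => w _.
  by rewrite (ipZr hE) (ipC hF) hAs (ipC hE u) mulrC.
have iXAY := integ_ip hE hX hAY.
have Qdom n w : (`|(ipE (X w) (Q n (A (Y w))))%:E| <= (`|X w| ^+ 2 + `|A (Y w)| ^+ 2)%:E)%E.
  rewrite lee_fin (le_trans (ip_le_sqr hE _ _)) // lerD2l ler_sqr ?nnegrE //.
  exact: (gs_proj_norm hE).
have [_ _] := @dominated_convergence _ _ _ P setT measurableT
  (fun n w => (ipE (X w) (Q n (A (Y w))))%:E) (fun w => (ipE (X w) (A (Y w)))%:E)
  (fun w => (`|X w| ^+ 2 + `|A (Y w)| ^+ 2)%:E)
  (fun n => measurable_int P (integ_ip hE hX (hQ n))) (measurable_int P iXAY)
  ltac:(by apply: aeW => w _; apply: cvg_EFin;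
         [exact: nearW|apply: (cvg_ip hE); exact: (cvg_gs_proj hE)])
  (integD hX.2 hAY.2)
  ltac:(by apply: aeW => w n _; exact: Qdom).
rewrite (integral_ip hE hX hAY).
under eq_fun do rewrite (integral_ip hE hX (hQ _)) Q0.
by move=> /(cvg_lim (@ereal_hausdorff R)); rewrite lim_cst // => -[].
Qed.

End Uncorrelated.
End L2.

(** * The pseudo-inverse of a symmetric operator, composed with an operator of smaller range *)

Section PseudoInverse.
Context {R : realType} {G H : completeNormedModType R}.
Context {ipH : H -> H -> R}.
Hypothesis hH : is_sep_hilbert ipH.

Lemma adherent_orth (M : set H) p k : adherent M p ->
  (forall m, M m -> ipH m k = 0) -> ipH p k = 0.
Proof.
move=> Mp Mk; apply/eqP; rewrite -normr_le0; apply/ler_addgt0Pr => e e0; rewrite add0r.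
have k1 : 0 < `|k| + 1 by rewrite ltr_wpDl.
have [m Mm hm] := Mp _ (divr_gt0 e0 k1).
have -> : ipH p k = ipH (p - m) k by rewrite (ipBl hH) (Mk _ Mm) subr0.
rewrite (le_trans (ip_le_norm hH _ _)) //; move: hm; rewrite ltr_pdivlMr // => hm.
by rewrite (le_trans _ (ltW hm)) // ler_wpM2l // lerDl.
Qed.

(** |p|^2 is the limit of <p, m> as [m] in [M] tends to [p], so testing against [M] is enough. *)
Lemma adherent_norm_le (M : set H) p c : adherent M p -> 0 <= c ->
  (forall m, M m -> `|ipH p m| <= c * `|m|) -> `|p| <= c.
Proof.
move=> Mp c0 Mc; have [->|p0] := eqVneq p 0; first by rewrite normr0.
have np : 0 < `|p| by rewrite normr_gt0.
rewrite -(ler_pM2r np) -expr2; apply/ler_addgt0Pr => e e0.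
have pc : 0 < `|p| + c by rewrite ltr_wpDr.
(* With [m] this close, |p||p - m| + c|p - m| < e, which absorbs both errors in |p|^2 <= |p||p - m|
   + c|m|. *)
have [m Mm hm] := Mp _ (divr_gt0 e0 pc).
rewrite -(ipxx hH) -{2}(subrK m p) (ipDr hH) (le_trans (ler_norm _)) //.
rewrite (le_trans (ler_normD _ _)) //.
have h1 : `|ipH p (p - m)| <= `|p| * `|p - m| by exact: (ip_le_norm hH).
have h2 : `|m| <= `|p| + `|p - m| by rewrite -[m in `|m|](subKr p) ler_normB.
have h3 : c * `|m| <= c * (`|p| + `|p - m|) by rewrite ler_wpM2l.
have gen (a a' t u v s : R) : t * (v + c) < s -> a <= v * t -> c * u <= c * (v + t) ->
  a' <= c * u -> a + a' <= c * v + s by move=> *; nra.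
by move: hm; rewrite ltr_pdivlMr // => hm; exact: gen hm h1 h3 (Mc _ Mm).
Qed.

(* Boundedness comes from the uniform boundedness principle, applied to the
   functionals [g |-> <T g, k>] with [|C k| <= 1]. *)
Lemma pinv_bounded (C : H -> H) (T : G -> H) :
  bounded_linear C -> bounded_linear T -> (forall x y, ipH (C x) y = ipH x (C y)) ->
  (forall g, exists h, C h = T g) ->
  exists2 B : G -> H, bounded_linear B &
    (forall g, C (B g) = T g) /\ (forall g k, C k = 0 -> ipH (B g) k = 0).
Proof.
move=> bC bT symC ranC.
have [lC _] := bC; have [lT _] := bT.
have C0 := bounded_linear0 bC.
have sM : linear_subspace (range C).
  split; first by exists 0.
  by move=> a p q [x _ <-] [y _ <-]; exists (a *: x + y).
have /choice[B hB] : forall g, exists b, adherent (range C) b /\ C b = T g.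
  move=> g; have [h hg] := ranC g; have [p [Mp orth]] := orth_proj hH h sM.
  exists p; split=> //.
  (* [h - p] is orthogonal to ran C, hence in ker C by symmetry, so [p] solves the same equation as
     [h]. *)
  have -> : p = (-1) *: (h - p) + h by rewrite scaleN1r opprB subrK.
  rewrite lC hg (_ : C (h - p) = 0) ?scaler0 ?add0r //.
  by apply: (ip_ext hH) => z; rewrite symC (ip0l hH); apply: orth; exists z.
have CB g : C (B g) = T g by case: (hB g).
have adhB g : adherent (range C) (B g) by case: (hB g).
have Bker g k : C k = 0 -> ipH (B g) k = 0.
  move=> Ck; apply: adherent_orth (adhB g) _ => _ [z _ <-].
  by rewrite symC Ck (ip0r hH).
exists B => //; split=> [a x y|].
  (* The linearity defect [D] lies in ker C and, by [Bker], is orthogonal to ker C, so it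
     vanishes. *)
  apply/eqP; rewrite -subr_eq0 -normr_eq0 -sqrf_eq0 -(ipxx hH); set D := _ - _.
  have CD : C D = 0.
    by rewrite /D addrC -scaleN1r lC lC !CB lT scaleN1r addNr.
  by rewrite {1}/D (ipBl hH) (ipDl hH) (ipZl hH) !Bker // mulr0 addr0 subr0.
pose F := [set f : G -> R^o | exists2 k, `|C k| <= 1 & f = fun g => ipH (T g) k].
have [CT CT0 hT] := bounded_linearP bT.
have uF : uniform_bounded F.
  apply: Banach_Steinhauss => [_ [k Ck ->]|g].
    split=> [r|a x y]; last by rewrite lT (ipDl hH) (ipZl hH).
    exists (CT * r * `|k|) => x xr; rewrite (le_trans (ip_le_norm hH _ _)) //.
    by rewrite ler_wpM2r // (le_trans (hT _)) // ler_wpM2l.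
  (* Pointwise bound at [g]: <T g, k> = <B g, C k>, and |C k| <= 1. *)
  exists `|B g| => _ [k Ck ->]; rewrite -CB symC (le_trans (ip_le_norm hH _ _)) //.
  by rewrite ler_piMr.
have [M hM] := uF 1.
have M0 : 0 <= M.
  have F0 : F (fun g => ipH (T g) 0) by exists 0; rewrite ?C0 ?normr0.
  by apply: le_trans (hM _ F0 0 _); rewrite ?normr0.
(* It suffices to test [B g] against [C k]. Below, [k] is divided by |C k| and [g] by |g|, so that
   the uniform bound [M] on the unit ball applies. *)
exists M => g; apply: adherent_norm_le (adhB g) _ _; first by rewrite mulr_ge0.
move=> _ [k _ <-].
have [->|Ck] := eqVneq (C k) 0; first by rewrite (ip0r hH) !normr0 mulr0.
have [->|g0] := eqVneq g 0.
  by rewrite -symC CB (bounded_linear0 bT) (ip0l hH) !normr0 mulr0 mul0r.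
rewrite -symC CB.
have nC : 0 < `|C k| by rewrite normr_gt0.
have ng : 0 < `|g| by rewrite normr_gt0.
have Fk : F (fun g => ipH (T g) (`|C k|^-1 *: k)).
  exists (`|C k|^-1 *: k) => //.
  by rewrite (bounded_linearZ _ _ bC) normrZ normfV normr_id mulVf // gt_eqF.
have := hM _ Fk (`|g|^-1 *: g).
rewrite normrZ normfV normr_id mulVf ?gt_eqF // => /(_ (lexx _)).
rewrite (bounded_linearZ _ _ bT) (ipZl hH) (ipZr hH) !normrM !normfV !normr_id.
by rewrite mulrA -invfM mulrC ler_pdivrMr ?mulr_gt0 // mulrA.
Qed.
End PseudoInverse.

(** * Means and cross-covariance operators *)

Section Covariance.
Context {R : realType} {d : measure_display} {Omega : measurableType d}.
Variable P : probability Omega R.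
Context {E F : completeNormedModType R} {ipE : E -> E -> R} {ipF : F -> F -> R}.
Hypotheses (hE : is_sep_hilbert ipE) (hF : is_sep_hilbert ipF).

Lemma L2ip_centered_cst X mu c : L2 P ipE X -> is_mean P ipE X mu ->
  L2ip P ipE (fun w => X w - mu) (fun=> c) = 0.
Proof.
move=> hX hmu; rewrite (L2ipBl hE hX (L2_cst P hE mu) (L2_cst P hE c)).
rewrite [X in _ - X](_ : _ = ipE mu c).
  by rewrite /L2ip /Rintegral hmu subrr.
rewrite /L2ip Rintegral_cst //. by rewrite [X in _ * fine X](_ : _ = 1%E) ?mulr1 //; exact: (probability_setT P).
Qed.

Lemma is_covP X Y muX muY (C : F -> E) e f : is_cov P ipE ipF X Y muX muY C ->
  \int[P]_w (ipE (X w - muX) e * ipF (Y w - muY) f) = ipE e (C f).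
Proof.
move=> hC; rewrite /Rintegral -[RHS]/(fine (ipE e (C f))%:E) -hC.
by congr fine; apply: eq_integral => w _; rewrite mulrC.
Qed.

(** [is_cov] determines [C] through its weak identity: linearity comes from testing against every
    [e], the bound from testing against e = C f. *)
Lemma cov_bounded_linear X Y muX muY (C : F -> E) : L2 P ipE X -> L2 P ipF Y ->
  is_cov P ipE ipF X Y muX muY C -> bounded_linear C.
Proof.
move=> hX hY hC.
have hX' := L2B hE hX (L2_cst P hE muX); have hY' := L2B hF hY (L2_cst P hF muY).
have iXY e f := integ_ip_mul hE hF e f hX' hY'.
split=> [a f g|].
  apply: (ip_ext hE) => e; rewrite !(ipC hE _ e) (ipDr hE) (ipZr hE) -!(is_covP _ _ hC).
  rewrite -(RintegralZl _ measurableT (iXY e f)).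
  rewrite -(RintegralD measurableT (integZ a (iXY e f)) (iXY e g)).
  by apply: eq_Rintegral => w _; rewrite (ipDr hF) (ipZr hF); ring.
have iK := integD hX'.2 hY'.2.
(* This constant dominates E[|X - muX||Y - muY|], since ab <= a^2 + b^2 for a, b >= 0. *)
exists (\int[P]_w (`|X w - muX| ^+ 2 + `|Y w - muY| ^+ 2)) => f.
have [->|C0] := eqVneq (C f) 0.
  rewrite normr0 mulr_ge0 //; apply: Rintegral_ge0 => w _.
  by rewrite addr_ge0 ?sqr_ge0.
rewrite -(@ler_pM2r _ `|C f|) ?normr_gt0 // -expr2 -(ipxx hE) -(is_covP _ _ hC).
rewrite -mulrA [_ * (`|f| * _)]mulrC -(RintegralZl _ measurableT iK).
apply: le_Rintegral => //; first exact: (integZ _ iK).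
move=> w _; rewrite (le_trans (ler_norm _)) // normrM.
have := ip_le_norm hE (X w - muX) (C f); have := ip_le_norm hF (Y w - muY) f.
move=> h1 h2; rewrite (le_trans (ler_pM _ _ h2 h1)) //.
by rewrite mulrACA mulrC [`|C f| * _]mulrC ler_wpM2l ?mulr_ge0 // mulr_le_sqrD.
Qed.

End Covariance.

(** * Best affine approximation in L^2 *)

Section LinearMMSE.
Context {R : realType} {d : measure_display} {Omega : measurableType d}.
Variable P : probability Omega R.
Context {G H : completeNormedModType R} {ipG : G -> G -> R} {ipH : H -> H -> R}.
Hypotheses (hG : is_sep_hilbert ipG) (hH : is_sep_hilbert ipH).
Variables (U : Omega -> G) (V : Omega -> H).
Hypotheses (hU : L2 P ipG U) (hV : L2 P ipH V).

Lemma L2_affine (A : H -> G) b : bounded_linear A -> L2 P ipG (fun w => b + A (V w)).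
Proof.
move=> bA; apply: (L2D hG (L2_cst P hG b)); exact: (L2_bounded_linear hH hG bA hV).
Qed.

(** For Z = W and Z = W', both candidates have the same L^2 inner product with [Z] as [U] has, so
    E|W' - W|^2 expands to 0. *)
Lemma affine_cond_exp_unique W W' : is_affine_cond_exp P ipG U V W ->
  is_affine_cond_exp P ipG U V W' -> {ae P, forall w, W' w = W w}.
Proof.
move=> [hW cW oW] [hW' cW' oW'].
have hUW := L2B hG hU hW; have hUW' := L2B hG hU hW'.
have hD := L2B hG hW' hW.
have orth X (hX : L2 P ipG X) (Z : Omega -> G) : L2 P ipG Z ->
    (\int[P]_w (ipG (U w - X w) (Z w))%:E)%E = 0%E -> L2ip P ipG U Z = L2ip P ipG X Z.
  move=> hZ; rewrite (integral_ip hG (L2B hG hU hX) hZ) (L2ipBl hG hU hX hZ).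
  by move=> [/eqP]; rewrite subr_eq0 => /eqP.
have D0 : L2ip P ipG (fun w => W' w - W w) (fun w => W' w - W w) = 0.
  rewrite (L2ipBl hG hW' hW hD) !(L2ipBr hG hW' hW) //.
  rewrite -(orth _ hW _ hW' (oW _ hW' cW')) -(orth _ hW _ hW (oW _ hW cW)).
  rewrite -(orth _ hW' _ hW' (oW' _ hW' cW')) -(orth _ hW' _ hW (oW' _ hW cW)).
  by rewrite subrr.
have mD := measurable_int P hD.2.
have := (ae_eq_integral_abs P measurableT mD).1.
rewrite [X in X = _](_ : _ = 0%E); last first.
  rewrite -[RHS]/(0%:E) -D0 -(integral_sqr_norm hG hD); apply: eq_integral => w _ /=.
  by rewrite ger0_norm ?sqr_ge0.
move=> /(_ erefl); apply: filterS => w /(_ I) /= [/eqP].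
by rewrite sqrf_eq0 normr_eq0 subr_eq0 => /eqP.
Qed.

Section Orthogonal.
Variable W : Omega -> G.
Hypothesis hW : L2 P ipG W.
Hypothesis orthW : forall b (A : H -> G), bounded_linear A ->
  L2ip P ipG (fun w => U w - W w) (fun w => b + A (V w)) = 0.

(** With D = U - W and [N] an affine function of [V] close to [Z], <D, Z> = <D, Z - N>, which
    [L2ip_amgm] makes small. *)
Lemma orth_affine_closure Z : L2 P ipG Z -> in_affine_closure P V Z ->
  L2ip P ipG (fun w => U w - W w) Z = 0.
Proof.
move=> hZ cZ; have hD := L2B hG hU hW.
apply/eqP; rewrite -normr_le0; apply/ler_addgt0Pr => e e0; rewrite add0r.
set q := L2ip P ipG (fun w => U w - W w) (fun w => U w - W w).
have q1 : 0 < q + 1 by rewrite ltr_wpDl // (L2ip_ge0 P hG).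
(* The weight t = e / (q + 1) and an approximation error below e t give 2|<D, Z>| <= t q + (e t) / t
   <= 2 e. *)
have t0 := divr_gt0 e0 q1.
have [b [A [bA]]] := cZ _ (mulr_gt0 e0 t0).
have hA := L2_affine b bA.
rewrite (integral_sqr_norm hG (L2B hG hZ hA)) lte_fin => hN.
have := L2ip_amgm hG hD (L2B hG hZ hA) t0.
rewrite (L2ipBr hG hZ hA hD) orthW // subr0 -/q.
move: hN; rewrite -ltr_pdivrMr //.
have : e / (q + 1) * q <= e by rewrite mulrAC ler_pdivrMr // ler_wpM2l ?(ltW e0) // lerDl.
move: (L2ip _ _ _ _) (L2ip _ _ _ _ / _) (_ * q) => x y z h1 h2 h3.
have : 2 * `|x| <= 2 * e by rewrite (le_trans h3) // mulr_natl mulr2n lerD // ltW.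
by rewrite ler_pM2l.
Qed.

(** Pythagoras: W - (b + A V) is again affine in [V], hence orthogonal to U - W. *)
Lemma orth_affine_minimizer b0 (A0 : H -> G) b (A : H -> G) :
  (forall w, W w = b0 + A0 (V w)) -> bounded_linear A0 -> bounded_linear A ->
  (\int[P]_w (`|U w - W w| ^+ 2)%:E <= \int[P]_w (`|U w - (b + A (V w))| ^+ 2)%:E)%E.
Proof.
move=> WE bA0 bA; have hD := L2B hG hU hW; have hA := L2_affine b bA.
have hN := L2B hG hW hA.
rewrite (integral_sqr_norm hG hD) (integral_sqr_norm hG (L2B hG hU hA)) lee_fin.
rewrite [leRHS](@L2ip_eq _ _ _ P _ ipG _ (fun w => (U w - W w) + (W w - (b + A (V w))))
  _ (fun w => (U w - W w) + (W w - (b + A (V w))))); last first.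
- by move=> w; rewrite addrA subrK.
- by move=> w; rewrite addrA subrK.
rewrite (L2ipDl hG hD hN (L2D hG hD hN)) !(L2ipDr hG hD hN) //.
rewrite (L2ipC P hG (fun w => W w - _)) (L2ipBr hG hW hA hD) orthW //.
rewrite {1 2}(_ : L2ip P ipG _ W = 0); last first.
  by rewrite -(orthW b0 bA0); apply: L2ip_eq.
by rewrite subr0 addr0 add0r lerDl (L2ip_ge0 P hG).
Qed.

End Orthogonal.
End LinearMMSE.
Unset Implicit Arguments.

Theorem mainTheorem8 (R : realType) (d : measure_display) (Omega : measurableType d)
  (P : probability Omega R)
  (G H : completeNormedModType R) (ipG : G -> G -> R) (ipH : H -> H -> R)
  (hG : is_sep_hilbert ipG) (hH : is_sep_hilbert ipH)
  (U : Omega -> G) (V : Omega -> H) (hU : L2 P ipG U) (hV : L2 P ipH V)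
  (muU : G) (muV : H) (hmuU : is_mean P ipG U muU) (hmuV : is_mean P ipH V muV)
  (CVU : G -> H) (CV : H -> H)
  (hCVU : is_cov P ipH ipG V U muV muU CVU) (hCV : is_cov P ipH ipH V V muV muV CV)
  (hran : forall g : G, exists h : H, CV h = CVU g) :
  exists (B : G -> H) (Bs : H -> G),
    [/\ bounded_linear B /\ (forall g, mp_pinv ipH ipH CV (CVU g) (B g)),
        is_adjoint ipG ipH B Bs,
        (forall (b : G) (A : H -> G), bounded_linear A ->
           (mse P U V (fun v => (muU + Bs (v - muV))%R) <= mse P U V (fun v => (b + A v)%R))%E),
        is_affine_cond_exp P ipG U V (fun w => muU + Bs (V w - muV)) &
        (forall W, is_affine_cond_exp P ipG U V W ->
           {ae P, forall w, W w = muU + Bs (V w - muV)})].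
Proof.
have symCV x y : ipH (CV x) y = ipH x (CV y).
  rewrite (ipC hH) -!(is_covP _ _ hCV).
  by apply: eq_Rintegral => w _; rewrite mulrC.
have [B bB [CB Bker]] := pinv_bounded hH (cov_bounded_linear hH hH hV hV hCV)
  (cov_bounded_linear hH hG hV hU hCVU) symCV hran.
have [Bs bBs hBs] := adjoint_exists hG hH bB.
have hU' := L2B hG hU (L2_cst P hG muU); have hV' := L2B hH hV (L2_cst P hH muV).
pose W w := muU + Bs (V w - muV).
(* Absorbing the centering into the constant exhibits [W] as an affine function of [V]. *)
have WE w : W w = (muU - Bs muV) + Bs (V w).
  by rewrite /W (bounded_linearB _ _ bBs) addrA addrAC.
have hW : L2 P ipG W.
  by rewrite (funext WE); exact: (L2_affine hG hH hV _ bBs).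
have hBV' := L2_bounded_linear hH hG bBs hV'.
have DE w : U w - W w = (U w - muU) - Bs (V w - muV) by rewrite /W opprD addrA.
have hD := L2B hG hU hW.
have orthW b (A : H -> G) : bounded_linear A ->
    L2ip P ipG (fun w => U w - W w) (fun w => b + A (V w)) = 0.
  move=> bA.
  have hAV' := L2_bounded_linear hH hG bA hV'.
  (* Recentre [V]: the constant part then falls to the means, the linear part to
     uncorrelatedness. *)
  have -> : L2ip P ipG (fun w => U w - W w) (fun w => b + A (V w)) =
      L2ip P ipG (fun w => U w - W w) (fun w => (b + A muV) + A (V w - muV)).
    apply: L2ip_eq => // w.
    by rewrite -addrA -(bounded_linearD _ _ bA) [muV + _]addrC subrK.
  rewrite (L2ipDr hG (L2_cst P hG _) hAV' hD).
  rewrite (L2ip_uncorrelated hG hH bA hD hV') ?addr0.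
    rewrite (@L2ip_eq _ _ _ P _ ipG _ _ _ _ DE (frefl _)).
    rewrite (L2ipBl hG hU' hBV' (L2_cst P hG _)) (L2ip_centered_cst hG _ hU hmuU).
    (* Moving [Bs] across the inner product leaves the centered [V] tested against a constant. *)
    rewrite sub0r -[X in - X](_ : L2ip P ipH (fun w => V w - muV) (fun=> B (b + A muV)) = _).
      by rewrite (L2ip_centered_cst hH _ hV hmuV) oppr0.
    by apply: eq_Rintegral => w _; rewrite hBs.
  (* E[<U - muU, g><V - muV, h>] = <CVU g, h>, and the term with [B] is <B g, CV h> = <CV (B g), h>,
     the same number. *)
  move=> g h.
  transitivity (\int[P]_w (ipG (U w - muU) g * ipH (V w - muV) h -
     ipH (V w - muV) (B g) * ipH (V w - muV) h)).
    by apply: eq_Rintegral => w _; rewrite DE (ipBl hG) hBs mulrBl.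
  rewrite (RintegralB measurableT (integ_ip_mul hG hH g h hU' hV')
    (integ_ip_mul hH hH (B g) h hV' hV')).
  rewrite (is_covP _ _ hCV) -symCV CB (ipC hH) -(is_covP _ _ hCVU).
  by apply/eqP; rewrite subr_eq0; apply/eqP; apply: eq_Rintegral => w _; rewrite mulrC.
have condW : is_affine_cond_exp P ipG U V W.
  split=> //.
    move=> e e0; exists (muU - Bs muV), Bs; split=> //.
    under eq_integral do rewrite -WE subrr normr0 expr0n /=.
    by rewrite integral0 lte_fin.
  move=> Z hZ cZ; rewrite (integral_ip hG hD hZ).
  by rewrite (orth_affine_closure hG hH hU hV hW orthW hZ cZ).
exists B, Bs; split => //.
- split=> // g; split; last exact: Bker.
  (* [CVU g] lies in ran CV, so its component orthogonal to ran CV is 0. *)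
  by exists 0; split=> [e|]; rewrite ?(ip0l hH) // addr0 CB.
- move=> b A bA; exact: (orth_affine_minimizer hG hH hU hV hW orthW b WE bBs bA).
- move=> W' hW'; exact: (affine_cond_exp_unique hG hU condW hW').
Qed.
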